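(* Let $\mathcal{A}_I = ((\mathfrak{A}_\hbar,\phi^I_\hbar)_{\hbar\in I},\mathfrak{A})$ be a $UC_b$ bundle of C*-algebras over a locally compact metric space $I$, let $J$ be a locally compact metric space, and let $\alpha: I\to J$ be a dense, isometric embedding. Suppose that $\mathcal{B}_J = ((\mathfrak{B}_\hbar,\phi^J_\hbar)_{\hbar\in J},\mathfrak{B})$ and $\mathcal{C}_J = ((\mathfrak{C}_\hbar,\psi^J_\hbar)_{\hbar\in J},\mathfrak{C})$ are two minimal extensions of $\mathcal{A}_I$ associated with $\alpha$. Then $\mathcal{B}_J$ and $\mathcal{C}_J$ are isomorphic as $UC_b$ bundles of C*-algebras.
   Context: For a metric space $I$, $UC_b(I)$ is the C*-algebra of bounded uniformly continuous functions $I\to\mathbb{C}$. C*-algebras are not assumed unital. A $UC_b$ bundle of C*-algebras over a metric space $I$, written $((\mathfrak{A}_\hbar,\phi^I_\hbar)_{\hbar\in I},\mathfrak{A})$, is a family of C*-algebras $(\mathfrak{A}_\hbar)_{\hbar\in I}$, a C*-algebra $\mathfrak{A}$ (the uniformly continuous sections), and *-homomorphisms $\phi^I_\hbar:\mathfrak{A}\to\mathfrak{A}_\hbar$ (evaluation maps) such that: (i) each $\phi^I_\hbar$ is surjective and $\|a\|=\sup_{\hbar\in I}\|\phi^I_\hbar(a)\|_\hbar$ for all $a\in\mathfrak{A}$; (ii) for each $f\in UC_b(I)$ and $a\in\mathfrak{A}$ there is an element $fa\in\mathfrak{A}$ with $\phi^I_\hbar(fa)=f(\hbar)\phi^I_\hbar(a)$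 for all $\hbar\in I$; (iii) for each $a\in\mathfrak{A}$, the function $\hbar\mapsto\|\phi^I_\hbar(a)\|_\hbar$ is in $UC_b(I)$. A homomorphism from $\mathcal{A}_I=((\mathfrak{A}_\hbar,\phi^I_\hbar)_{\hbar\in I},\mathfrak{A})$ to $\mathcal{B}_J=((\mathfrak{B}_\hbar,\phi^J_\hbar)_{\hbar\in J},\mathfrak{B})$ is a pair $\sigma=(\alpha,\beta)$ where $\alpha:I\to J$ is a metric map (i.e. $d_J(\alpha(x),\alpha(y))\le d_I(x,y)$ for all $x,y\in I$), $\beta:\mathfrak{A}\to\mathfrak{B}$ is a *-homomorphism, and for all $a_1,a_2\in\mathfrak{A}$ and $\hbar\in I$: if $\phi^I_\hbar(a_1)=\phi^I_\hbar(a_2)$, then $\phi^J_{\alpha(\hbar)}(\beta(a_1))=\phi^J_{\alpha(\hbar)}(\beta(a_2))$. It is an isomorphism if $\alpha$ is an isometry of $I$ onto $J$ and $\beta$ is a *-isomorphism. Let $\mathcal{A}_I$, $\mathcal{B}_J$ be $UC_b$ bundles over locally compact metric spaces. $\mathcal{B}_J$ is an extension of $\mathcal{A}_I$ (associated with $\alpha$ via $\sigma$) if there is a monomorphism $\sigma=(\alpha,\beta):\mathcal{A}_I\to\mathcal{B}_J$, i.e. a homomorphism with $\alpha$ and $\beta$ both injective. It is a minimal extension if, moreover, $\alpha$ and $\beta$ are dense embeddings: $\alpha$ is an isometry onto its image and $\alpha[I]$ is dense in $J$; $\beta[\mathfrak{A}]$ is norm dense in $\mathfrak{B}$. A dense,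 isometric embedding $\alpha:I\to J$ is a map that is an isometry onto its image and has dense image (it need not be bijective). *)

(* Defs.v *)
From HB Require Import structures.
From mathcomp Require Import all_boot all_order all_algebra.
From mathcomp Require Import complex.
From mathcomp Require Import all_classical all_reals all_analysis.
Set Implicit Arguments.
Unset Strict Implicit.
Unset Printing Implicit Defensive.
Import Order.TTheory GRing.Theory Num.Theory.
Import numFieldTopology.Exports numFieldNormedType.Exports.

Local Open Scope classical_set_scope.
Local Open Scope ring_scope.
Local Open Scope complex_scope.

(* The norm of a normed module over [R[i]] takes values in [R[i]], where [<=]
   only relates numbers with the same imaginary part: a norm is a nonnegative
   real number, seen in [R[i]]. The multiplication is a field of the mixin,
   because the library's ring structures all have a unit. *)
HB.mixin Record CompleteNormedModule_isCStarAlgebra (R : realType) A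
    of CompleteNormedModule R[i] A := {
  cmul : A -> A -> A;
  cstar : A -> A;
  cmulA : associative cmul;
  cmulDl : left_distributive cmul +%R;
  cmulDr : right_distributive cmul +%R;
  cmulZl : forall (k : R[i]) (a b : A), cmul (k *: a) b = k *: cmul a b;
  cmulZr : forall (k : R[i]) (a b : A), cmul a (k *: b) = k *: cmul a b;
  cstarK : involutive cstar;
  cstarD : {morph cstar : a b / a + b};
  cstarZ : forall (k : R[i]) (a : A), cstar (k *: a) = k^* *: cstar a;
  cstarM : forall a b : A, cstar (cmul a b) = cmul (cstar b) (cstar a);
  normr_cmul : forall a b : A, `|cmul a b| <= `|a| * `|b|;
  normr_cstarM : forall a : A, `|cmul (cstar a) a| = `|a| ^+ 2
}.

#[short(type="cstarAlgType")]
HB.structure Definition CStarAlgebra (R : realType) :=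
  { A of CompleteNormedModule_isCStarAlgebra R A & CompleteNormedModule R[i] A }.

Record star_hom (R : realType) (A B : cstarAlgType R) (f : A -> B) : Prop := {
  star_hom_linear : linear f;
  star_hom_mul : {morph f : a b / cmul a b};
  star_hom_star : {morph f : a / cstar a}
}.

Definition UCb (R : realType) (I : metricType R) (f : I -> R[i]) : Prop :=
  unif_continuous (f : I -> R[i]^o) /\ bounded_fun (f : I -> R[i]^o).

(* The suprema below are real, while norms live in [R[i]], hence [Re]. The sets
   of norms are bounded by [norm_UCb], so [sup] is a genuine supremum when [I]
   is nonempty; for empty [I], [sup set0 = 0] is the supremum in [0, +oo[. *)
Record UCb_bundle (R : realType) (I : metricType R) := {
  fiber : I -> cstarAlgType R;
  sections : cstarAlgType R;
  eval : forall h : I, sections -> fiber h;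
  eval_star_hom : forall h, star_hom (eval h);
  eval_surj : forall h (b : fiber h), exists a, eval h a = b;
  norm_sup : forall a, `|a| = (sup (range (fun h => complex.Re `|eval h a|)))%:C;
  UCb_scale : forall f : I -> R[i], UCb f ->
    forall a, exists fa, forall h, eval h fa = f h *: eval h a;
  norm_UCb : forall a, UCb (fun h => `|eval h a|)
}.

Definition metric_map (R : realType) (I J : metricType R) (f : I -> J) :=
  forall x y, mdist (f x) (f y) <= mdist x y.

Definition isometric (R : realType) (I J : metricType R) (f : I -> J) :=
  forall x y, mdist (f x) (f y) = mdist x y.

Record bundle_hom (R : realType) (I J : metricType R)
    (A : UCb_bundle I) (B : UCb_bundle J) := {
  base_map : I -> J;
  section_map : sections A -> sections B;
  base_map_metric : metric_map base_map;
  section_map_star_hom : star_hom section_map;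
  fiber_compat : forall (a1 a2 : sections A) (h : I),
    eval h a1 = eval h a2 ->
    eval (base_map h) (section_map a1) = eval (base_map h) (section_map a2)
}.

Section Morphisms.
Context (R : realType) (I J : metricType R).
Implicit Types (A : UCb_bundle I) (B : UCb_bundle J).

Definition bundle_mono A B (s : bundle_hom A B) : Prop :=
  injective (base_map s) /\ injective (section_map s).

Definition bundle_iso A B (s : bundle_hom A B) : Prop :=
  [/\ isometric (base_map s), range (base_map s) = [set: J]
    & bijective (section_map s)].

Definition isomorphic A B : Prop := exists s : bundle_hom A B, bundle_iso s.

Definition minimal_extension (alpha : I -> J) A B : Prop :=
  exists s : bundle_hom A B,
    [/\ base_map s = alpha, bundle_mono s,
        isometric (base_map s), dense (range (base_map s))
      & dense (range (section_map s))].

End Morphisms.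

(* Main.v *)
Require Import Defs.
From HB Require Import structures.
From mathcomp Require Import all_boot all_order all_algebra.
From mathcomp Require Import all_classical all_reals all_analysis.
From mathcomp Require Import complex lra.

Set Implicit Arguments.
Unset Strict Implicit.
Unset Printing Implicit Defensive.

Import Order.TTheory GRing.Theory Num.Theory.
Import numFieldTopology.Exports numFieldNormedType.Exports.

Local Open Scope classical_set_scope.
Local Open Scope ring_scope.
Local Open Scope complex_scope.

(** An injective *-homomorphism between C*-algebras is isometric, so its range
is complete, hence closed. The section maps [beta : A -> B] and
[gamma : A -> C] of two minimal extensions are injective with dense range;
they are therefore *-isomorphisms, and [delta = gamma \o beta^-1] is a
*-isomorphism of the section algebras (lemmas [star_hom_inj_isometric] and
[star_hom_dense_surj]).

It remains to see that [delta] respects the fibers over every [j] in [J], not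
only over the image of [alpha]. If [beta a] vanishes at [j], then its norm is
small near [j], so [f (beta a)] is small for a bump function [f] centered at
[j]. On the image of [alpha], compatibility with the fibers gives
[beta ((f \o alpha) a) = f (beta a)] and the same for [gamma]; both equalities
extend to [J] by density and continuity of the norms
([section_map_scale]). As [beta] is isometric and [gamma] contractive,
[f (gamma a) = gamma ((f \o alpha) a)] is small, and its value at [j] is that of
[gamma a] since [f j = 1] ([kernel_transfer]).

The isometry of injective *-homomorphisms is proved without spectral theory.
The only analytic tool is the square root of [1 - z] for [`|z| <= 1]
([sqrt_one_sub]); the algebra may have no unit, so one works with
[w = 1 - sqrt (1 - z)], which satisfies [2 w = z + w ^ 2] and lies in the
algebra.
- Contractivity: a self-adjoint [b] of norm at most [1] has a cosine
  [1 - d = sqrt (1 - b ^ 2)]. The relation [b ^ 2 + (1 - d) ^ 2 = 1] is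
  preserved by homomorphisms, and it implies [`|b| <= 1] because
  [b + i (1 - d)] is unitary ([rnorm_le1_of_circle]).
- Isometry: with [b] and [d] as above let [x = 2 b ^ 2] and
  [e = 2 b (1 - d)], so that [1 - e ^ 2 = (1 - x) ^ 2]. Let [1 - w] be the
  positive square root of the same element. In spectral terms
  [1 - w = `|1 - x|], and [x = w] exactly when the spectrum of [x] is in
  [[0, 1]]. If the image of [x] has norm less than [1], then the images of [w]
  and [x] coincide, so [x = w] by injectivity and [`|x| <= 1]
  ([star_hom_inj_sqr]). *)

Local Notation "a ** b" := (cmul a b) (at level 40, left associativity).
Local Notation "a ^#" := (cstar a) (at level 2, format "a ^#").

(** * The real-valued norm *)

(** Norms take values in [R[i]], which is only partially ordered; their real
parts carry the same information and allow linear arithmetic. *)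
Definition rnorm (R : realType) (V : normedModType R[i]) (a : V) : R :=
  complex.Re `|a|.

Section RealNorm.
Context (R : realType) (V : normedModType R[i]).
Implicit Types a b : V.

Lemma rnormE a : `|a| = (rnorm a)%:C.
Proof. by rewrite /rnorm RRe_real// normr_real. Qed.

Lemma rnorm_ge0 a : 0 <= rnorm a.
Proof. by rewrite -lecR -rnormE normr_ge0. Qed.

Lemma rnorm0 : rnorm (0 : V) = 0.
Proof. by rewrite /rnorm normr0. Qed.

Lemma rnorm0_eq0 a : rnorm a = 0 -> a = 0.
Proof. by move=> a0; apply/normr0_eq0; rewrite rnormE a0. Qed.

Lemma rnormD a b : rnorm (a + b) <= rnorm a + rnorm b.
Proof. by rewrite -lecR rmorphD/= -!rnormE ler_normD. Qed.

Lemma rnormN a : rnorm (- a) = rnorm a.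
Proof. by rewrite /rnorm normrN. Qed.

Lemma rnormB a b : rnorm (a - b) <= rnorm a + rnorm b.
Proof. by rewrite -(rnormN b) rnormD. Qed.

Lemma rnorm_distC a b : rnorm (a - b) = rnorm (b - a).
Proof. by rewrite /rnorm distrC. Qed.

Lemma rnorm_distD c a b : rnorm (a - b) <= rnorm (a - c) + rnorm (c - b).
Proof. by rewrite -(subrKA c) rnormD. Qed.

Lemma rnormZ (k : R) a : rnorm (k%:C *: a) = `|k| * rnorm a.
Proof.
apply: complexI; rewrite rmorphM/= -!rnormE normrZ; congr (_ * _).
by rewrite normc_def/= expr0n/= addr0 sqrtr_sqr.
Qed.

Lemma rnormZi a : rnorm ('i%R *: a) = rnorm a.
Proof. by rewrite /rnorm normrZ normCi mul1r. Qed.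

Lemma rnorm_le_eps (K : R) a : (forall e, 0 < e -> rnorm a <= K * e) -> a = 0.
Proof.
move=> small; apply: rnorm0_eq0; apply/eqP; rewrite eq_le rnorm_ge0 andbT.
apply/ler_addgt0Pl => e e0; rewrite addr0.
have K1 : 0 < `|K| + 1 by rewrite ltr_wpDl.
apply: (le_trans (small (e / (`|K| + 1)) _)); first by rewrite divr_gt0.
rewrite mulrCA ger_pMr// ler_pdivrMr// mul1r.
by have := ler_norm K; lra.
Qed.

End RealNorm.

(** The Cauchy condition and the limit are stated with [rnorm], so that later
limit arguments are estimates with real numbers. *)
Lemma rnorm_complete (R : realType) (V : completeNormedModType R[i])
    (u : nat -> V) :
  (forall e, 0 < e -> exists N, forall n, (N <= n)%N -> rnorm (u n - u N) < e) ->
  exists l, forall e, 0 < e ->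
    exists N, forall n, (N <= n)%N -> rnorm (l - u n) < e.
Proof.
move=> cauchy_u.
have : cauchy (u @ \oo).
  apply: cauchy_exP => e; rewrite ltcE /= => /andP[/eqP Im0 e0].
  have [N uN] := cauchy_u _ e0.
  exists (u N), N => // n /= Nn.
  rewrite -ball_normE/= rnormE rnorm_distC ltcE/= Im0 eqxx/=.
  exact: uN.
move=> /cauchy_cvg/cvg_ex[l u_l]; exists l => e e0.
have e0' : (0 : R[i]) < e%:C by rewrite ltcR.
have /cvgrPdist_lt/(_ _ e0')[N _ uN] := u_l.
by exists N => n /uN /=; rewrite rnormE ltcR.
Qed.

(** * Arithmetic of C*-algebras *)

Section Arithmetic.
Context (R : realType) (A : cstarAlgType R).
Implicit Types a b c : A.

Lemma cmulNl a b : (- a) ** b = - (a ** b).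
Proof. by rewrite -scaleN1r cmulZl scaleN1r. Qed.

Lemma cmulNr a b : a ** (- b) = - (a ** b).
Proof. by rewrite -scaleN1r cmulZr scaleN1r. Qed.

Lemma cmul0r a : 0 ** a = 0.
Proof. by rewrite -(scale0r a) cmulZl !scale0r. Qed.

Lemma cmulr0 a : a ** 0 = 0.
Proof. by rewrite -(scale0r a) cmulZr !scale0r. Qed.

Lemma cmulBl a b c : (a - b) ** c = a ** c - b ** c.
Proof. by rewrite cmulDl cmulNl. Qed.

Lemma cmulBr a b c : a ** (b - c) = a ** b - a ** c.
Proof. by rewrite cmulDr cmulNr. Qed.

Lemma cmulMnl a b n : (a *+ n) ** b = (a ** b) *+ n.
Proof. by rewrite -scaler_nat cmulZl scaler_nat. Qed.

Lemma cmulMnr a b n : a ** (b *+ n) = (a ** b) *+ n.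
Proof. by rewrite -scaler_nat cmulZr scaler_nat. Qed.

Lemma cstarN a : (- a)^# = - a^#.
Proof. by rewrite -scaleN1r cstarZ rmorphN rmorph1 scaleN1r. Qed.

Lemma cstar0 : (0 : A)^# = 0.
Proof. by rewrite -(scale0r (0 : A)) cstarZ rmorph0 !scale0r. Qed.

Lemma cstarB a b : (a - b)^# = a^# - b^#.
Proof. by rewrite cstarD cstarN. Qed.

Lemma cstarZr (k : R) a : (k%:C *: a)^# = k%:C *: a^#.
Proof. by rewrite cstarZ conj_Creal ?complex_real. Qed.

Lemma cmul_self_sub a b : a ** a - b ** b = a ** (a - b) + (a - b) ** b.
Proof. by rewrite cmulBr cmulBl subrKA. Qed.

Lemma rnormM a b : rnorm (a ** b) <= rnorm a * rnorm b.
Proof. by rewrite -lecR rmorphM/= -!rnormE normr_cmul. Qed.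

Lemma rnorm_starM a : rnorm (a^# ** a) = rnorm a ^+ 2.
Proof. by apply: complexI; rewrite rmorphXn/= -!rnormE normr_cstarM. Qed.

Lemma rnorm_sqr a : a^# = a -> rnorm (a ** a) = rnorm a ^+ 2.
Proof. by move=> sa; rewrite -rnorm_starM sa. Qed.

Lemma rnorm_star a : rnorm a^# = rnorm a.
Proof.
have le_star b : rnorm b <= rnorm b^#.
  have [->|b0] := eqVneq (rnorm b) 0; first exact: rnorm_ge0.
  have b_gt0 : 0 < rnorm b by rewrite lt_def b0 rnorm_ge0.
  by rewrite -(ler_pM2r b_gt0) -expr2 -rnorm_starM rnormM.
by apply/le_anti; rewrite le_star andbT -{2}(cstarK a) le_star.
Qed.

End Arithmetic.

(** * The square root of 1 - z *)

Section SquareRoot.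
Context (R : realType) (A : cstarAlgType R).
Implicit Types a b c : A.

(** [root_iter z] has limit [1 - sqrt (1 - z)]. It is a sequence of polynomials
in [z] with nonnegative coefficients and no constant term, and [root_major n]
is the value of the [n]-th polynomial at [1]; it bounds the norm of
[root_iter z n] when [`|z| <= 1]. *)
Fixpoint root_major (n : nat) : R :=
  if n is m.+1 then (1 + root_major m ^+ 2) / 2 else 0.

Fixpoint root_iter (z : A) (n : nat) : A :=
  if n is m.+1 then (2^-1 : R)%:C *: (z + root_iter z m ** root_iter z m)
  else 0.

Lemma root_major_bounds n : 0 <= root_major n <= 1.
Proof. by elim: n => [|n /andP[q0 q1]] /=; rewrite ?lexx ?ler01//; nra. Qed.

Lemma root_major_cauchy (e : R) : 0 < e ->
  exists N, forall n, (N <= n)%N -> root_major n - root_major N < e.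
Proof.
move=> e0.
have q1 n : root_major n <= 1 by case/andP: (root_major_bounds n).
have sq : has_sup (range root_major).
  by split; [exists (root_major 0), 0 | exists 1 => _ [n _ <-]].
have [_ [N _ <-] qN] := sup_adherent e0 sq.
exists N => n _.
have : root_major n <= sup (range root_major).
  by apply: ub_le_sup; [exact: sq.2 | exists n].
by lra.
Qed.

Context (z : A) (z1 : rnorm z <= 1).

Let w := root_iter z.
Let q := root_major.

Lemma rnorm_root_iter n : rnorm (w n) <= q n.
Proof.
elim: n => [|n IH] /=; first by rewrite rnorm0.
rewrite rnormZ ger0_norm ?invr_ge0// mulrC ler_pM2r ?invr_gt0//.
have := rnormD z (w n ** w n); have := rnormM (w n) (w n).
have := rnorm_ge0 (w n); rewrite /q in IH *; move: IH z1; rewrite -/w; nra.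
Qed.

(** [w n.+2 - w n.+1] is half the difference of the squares of [w n.+1] and
[w n], and so is the corresponding increment of [q]; expanding both
differences of squares gives the bound by induction. *)
Lemma rnorm_root_iter_step n : rnorm (w n.+1 - w n) <= q n.+1 - q n.
Proof.
elim: n => [|n IH].
  rewrite !subr0 (le_trans (rnorm_root_iter 1))//.
have -> : w n.+2 - w n.+1 = (2^-1 : R)%:C *: (w n.+1 ** w n.+1 - w n ** w n).
  by rewrite /w /= -scalerBr opprD addrACA subrr add0r.
rewrite rnormZ ger0_norm ?invr_ge0// cmul_self_sub.
have n0 := rnorm_root_iter n; have n1 := rnorm_root_iter n.+1.
have d0 := rnorm_ge0 (w n.+1 - w n).
have h1 : rnorm (w n.+1 ** (w n.+1 - w n)) <= q n.+1 * (q n.+1 - q n).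
  by rewrite (le_trans (rnormM _ _))// ler_pM ?rnorm_ge0.
have h2 : rnorm ((w n.+1 - w n) ** w n) <= (q n.+1 - q n) * q n.
  by rewrite (le_trans (rnormM _ _))// ler_pM ?rnorm_ge0.
have := rnormD (w n.+1 ** (w n.+1 - w n)) ((w n.+1 - w n) ** w n).
have -> : q n.+2 - q n.+1 = 2^-1 * (q n.+1 * (q n.+1 - q n) + (q n.+1 - q n) * q n).
  have qS m : q m.+1 = (1 + q m ^+ 2) / 2 by [].
  by rewrite (qS n.+1); have := qS n; lra.
by move=> h; rewrite ler_pM2l ?invr_gt0//; lra.
Qed.

Lemma root_iter_cvg : exists l : A, forall e, 0 < e ->
  exists n, rnorm (l - w n) <= e /\ rnorm (l - w n.+1) <= e.
Proof.
have [|l lw] := @rnorm_complete R A w.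
  move=> e /root_major_cauchy[N qN]; exists N => n Nn.
  apply: le_lt_trans (qN _ Nn); rewrite -(subnK Nn).
  elim: (n - N)%N => [|k IH]; first by rewrite !subrr rnorm0.
  have := rnorm_distD (w (k + N)) (w (k.+1 + N)) (w N).
  by have := rnorm_root_iter_step (k + N); rewrite addSn /q; lra.
exists l => e /lw[N wN]; exists N; split; apply/ltW/wN; first exact: leqnn.
exact: leqnSn.
Qed.

(** [w] is [1 - sqrt (1 - z)]. The bound holds up to [`|z| = 1], where the
iteration is no longer a strict contraction and convergence comes from the
scalar majorant alone. Commutation is with everything that commutes with [z],
since [w] is a limit of polynomials in [z]. *)
Lemma sqrt_one_sub : exists w : A,
  [/\ rnorm w <= 1, w *+ 2 = z + w ** w,
      forall x, x ** z = z ** x -> x ** w = w ** x & z^# = z -> w^# = w].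
Proof.
have [l lw] := root_iter_cvg; exists l.
have w1 n : rnorm (w n) <= 1.
  by rewrite (le_trans (rnorm_root_iter n))//; case/andP: (root_major_bounds n).
have l1 : rnorm l <= 1.
  apply/ler_addgt0Pl => e /lw[n [ln _]].
  by have := rnormD (l - w n) (w n); rewrite subrK; have := w1 n; lra.
split=> // [|x xz|sz].
- apply/subr0_eq; apply: (@rnorm_le_eps _ _ 4) => e e0.
  have [n [ln lSn]] := lw _ e0.
  have -> : l *+ 2 - (z + l ** l) =
      (l - w n.+1) *+ 2 - (l ** (l - w n) + (l - w n) ** w n).
    rewrite -cmul_self_sub [w n.+1]/= mulrnBl -(scaler_nat 2 (_ *: _)) scalerA.
    have -> : (2%:R : R[i]) * (2^-1 : R)%:C = 1.
      by rewrite -(rmorph_nat (real_complex R)) -rmorphM/= divff ?rmorph1// pnatr_eq0.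
    rewrite scale1r -/w; move: (l *+ 2) => u.
    by rewrite opprB -addrA; congr (_ + _); rewrite !opprD addrA subrK.
  have h1 := rnormM l (l - w n); have h2 := rnormM (l - w n) (w n).
  have h3 := rnormD (l ** (l - w n)) ((l - w n) ** w n).
  have h4 := rnormD (l - w n.+1) (l - w n.+1).
  have h5 := rnormB ((l - w n.+1) *+ 2) (l ** (l - w n) + (l - w n) ** w n).
  have h6 : rnorm l * rnorm (l - w n) <= 1 * e by rewrite ler_pM ?rnorm_ge0.
  have h7 : rnorm (l - w n) * rnorm (w n) <= e * 1 by rewrite ler_pM ?rnorm_ge0.
  by rewrite -mulr2n in h4; lra.
- have xw n : x ** w n = w n ** x.
    elim: n => [|n IH]; first by rewrite /w/= cmul0r cmulr0.
    by rewrite /w/= -/w cmulZr cmulZl cmulDr cmulDl xz cmulA IH -!cmulA IH.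
  apply/subr0_eq; apply: (@rnorm_le_eps _ _ (rnorm x * 2)) => e e0.
  have [n [ln _]] := lw _ e0.
  have -> : x ** l - l ** x = x ** (l - w n) - (l - w n) ** x.
    by rewrite cmulBr cmulBl xw opprB subrKA.
  have h1 := rnormM x (l - w n); have h2 := rnormM (l - w n) x.
  have h3 := rnormB (x ** (l - w n)) ((l - w n) ** x).
  have h4 : rnorm x * rnorm (l - w n) <= rnorm x * e by rewrite ler_wpM2l ?rnorm_ge0.
  by rewrite [_ * rnorm x]mulrC in h2; lra.
have sw n : (w n)^# = w n.
  elim: n => [|n IH]; first by rewrite /w/= cstar0.
  by rewrite /w/= -/w cstarZr cstarD cstarM IH sz.
apply/subr0_eq; apply: (@rnorm_le_eps _ _ 2) => e e0.
have [n [ln _]] := lw _ e0.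
have -> : l^# - l = (l - w n)^# - (l - w n) by rewrite cstarB sw opprB subrKA.
have := rnormB (l - w n)^# (l - w n); rewrite rnorm_star; lra.
Qed.

End SquareRoot.

(** * Unitaries bound the norms of their real and imaginary parts *)

Section SumOfSquares.
Context (R : realType) (A : cstarAlgType R).
Implicit Types a b c : A.

(** [p + i q] and its adjoint [p - i q] both have norm [`|c|] by the C*-identity,
and [p] is half their sum. *)
Lemma rnorm_le_sum_sqr (p q c : A) : p^# = p -> q^# = q -> c^# = c ->
  p ** q = q ** p -> p ** p + q ** q = c ** c -> rnorm p <= rnorm c.
Proof.
move=> sp sq sc pq ppqq.
pose u := p + 'i%R *: q; pose v := p - 'i%R *: q.
have su : u^# = v by rewrite cstarD cstarZ conjCi sp sq scaleNr.
have sv : v^# = u by rewrite -su cstarK.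
have vu : v ** u = c ** c.
  rewrite -ppqq /u /v cmulBl !cmulDr !cmulZr !cmulZl scalerA -expr2 sqrCi.
  by rewrite scaleN1r pq opprD opprK addrA addrK.
have uv : u ** v = c ** c.
  rewrite -ppqq /u /v cmulBr !cmulDl !cmulZr !cmulZl scalerA -expr2 sqrCi.
  by rewrite scaleN1r pq opprD opprK addrA addrK.
have nc x : rnorm x ^+ 2 = rnorm c ^+ 2 -> rnorm x = rnorm c.
  by move=> /eqP; rewrite eqrXn2 ?rnorm_ge0// => /eqP.
have nu : rnorm u = rnorm c by apply: nc; rewrite -rnorm_starM su vu rnorm_sqr.
have nv : rnorm v = rnorm c by apply: nc; rewrite -rnorm_starM sv uv rnorm_sqr.
have := rnormD u v; rewrite nu nv.
have -> : u + v = (2 : R)%:C *: p.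
  by rewrite /u /v addrACA subrr addr0 rmorph_nat scaler_nat mulr2n.
by rewrite rnormZ ger0_norm//; lra.
Qed.

(** With the formal cosine [c = 1 - d], the element [b - b d] is [b c], and
[(b c) ^ 2 = b ^ 2 (1 - b ^ 2)]. *)
Lemma cosine_sub_sqr b d : b ** d = d ** b -> d *+ 2 = b ** b + d ** d ->
  (b - b ** d) ** (b - b ** d) = b ** b - (b ** b) ** (b ** b).
Proof.
move=> bd dd.
have bdb : b ** d ** b = b ** b ** d by rewrite -cmulA -bd cmulA.
have -> : (b ** b) ** (b ** b) = (b ** b) ** (d *+ 2 - d ** d).
  by rewrite dd addrK.
rewrite mulr2n !cmulBl !cmulBr cmulDr !cmulA bdb.
by rewrite -addrA -opprD addrA.
Qed.

Lemma cosine_sub_comm b d : b ** d = d ** b ->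
  (b - b ** d) ** (b ** b) = (b ** b) ** (b - b ** d).
Proof.
move=> bd.
have bdb : b ** d ** b = b ** b ** d by rewrite -cmulA -bd cmulA.
by rewrite cmulBr cmulBl !cmulA bdb -!cmulA -bd.
Qed.

(** The hypothesis says [b ^ 2 + (1 - d) ^ 2 = 1] without a unit. Multiplying it
by [b ^ 2] gives a relation between elements of the algebra, to which
[rnorm_le_sum_sqr] applies: it yields [`|b ^ 2| <= `|b|]. *)
Lemma rnorm_le1_of_circle b d : b^# = b -> d^# = d -> b ** d = d ** b ->
  d *+ 2 = b ** b + d ** d -> rnorm b <= 1.
Proof.
move=> sb sd bd dd.
have le : rnorm (b ** b) <= rnorm b.
  apply: (@rnorm_le_sum_sqr _ (b - b ** d)) => //.
  - by rewrite cstarM sb.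
  - by rewrite cstarB cstarM sb sd bd.
  - by rewrite cosine_sub_comm.
  by rewrite cosine_sub_sqr// addrC subrK.
have [->|b0] := eqVneq (rnorm b) 0; first exact: ler01.
have b_gt0 : 0 < rnorm b by rewrite lt_def b0 rnorm_ge0.
by rewrite -(ler_pM2r b_gt0) mul1r -expr2 -rnorm_sqr.
Qed.

Lemma exists_cosine b : b^# = b -> rnorm b <= 1 -> exists d,
  [/\ d^# = d, b ** d = d ** b & d *+ 2 = b ** b + d ** d].
Proof.
move=> sb b1.
have [|d [_ d2 comm_d star_d]] := @sqrt_one_sub _ _ (b ** b).
  by rewrite rnorm_sqr// exprn_ile1 ?rnorm_ge0.
exists d; split=> //; first by apply: star_d; rewrite cstarM sb.
by apply: comm_d; rewrite cmulA.
Qed.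

End SumOfSquares.

(** * Injective homomorphisms are isometric *)

Section StarHom.
Context (R : realType) (A B : cstarAlgType R) (f : A -> B) (hf : star_hom f).
Implicit Types a b : A.

Let flin : {linear A -> B} :=
  HB.pack f (GRing.isLinear.Build _ _ _ _ f (star_hom_linear hf)).

Lemma star_hom0 : f 0 = 0. Proof. exact: (linear0 flin). Qed.

Lemma star_homD a b : f (a + b) = f a + f b.
Proof. exact: (linearD flin). Qed.

Lemma star_homB a b : f (a - b) = f a - f b.
Proof. exact: (linearB flin). Qed.

Lemma star_homMn a n : f (a *+ n) = f a *+ n.
Proof. exact: (linearMn flin). Qed.

Lemma star_homZ (k : R[i]) a : f (k *: a) = k *: f a.
Proof. exact: (linearZ_LR flin). Qed.

Lemma star_hom_sa a : a^# = a -> (f a)^# = f a.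
Proof. by move=> sa; rewrite -(star_hom_star hf) sa. Qed.

Lemma star_hom_comm a b : a ** b = b ** a -> f a ** f b = f b ** f a.
Proof. by move=> ab; rewrite -!(star_hom_mul hf) ab. Qed.

Lemma star_hom_le1 a : a^# = a -> rnorm a <= 1 -> rnorm (f a) <= 1.
Proof.
move=> sa /(exists_cosine sa)[d [sd ad dd]].
apply: (@rnorm_le1_of_circle _ _ _ (f d)); rewrite ?star_hom_sa//.
  exact: star_hom_comm.
by rewrite -star_homMn dd star_homD !(star_hom_mul hf).
Qed.

Lemma star_hom_contractive a : rnorm (f a) <= rnorm a.
Proof.
have sa_case b : b^# = b -> rnorm (f b) <= rnorm b.
  move=> sb; have [b0|b0] := eqVneq (rnorm b) 0.
    by rewrite (rnorm0_eq0 b0) star_hom0 !rnorm0.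
  have b_gt0 : 0 < rnorm b by rewrite lt_def b0 rnorm_ge0.
  have := @star_hom_le1 ((rnorm b)^-1%:C *: b).
  rewrite cstarZr sb star_homZ !rnormZ ger0_norm ?invr_ge0 ?rnorm_ge0//.
  by rewrite mulVf// lexx ler_pdivrMl// mulr1; exact.
rewrite -(@ler_pXn2r _ 2) ?nnegrE ?rnorm_ge0// -!rnorm_starM.
by rewrite -(star_hom_star hf) -(star_hom_mul hf) sa_case// cstarM cstarK.
Qed.

Hypothesis f_inj : injective f.

(** The double angle [x = 2 b ^ 2], [e = 2 b (1 - d)] is again a point of the
circle, [e ^ 2 + (1 - x) ^ 2 = 1], so [`|e| <= 1], and [1 - e ^ 2] has a
second square root [1 - w]: [2 w - w ^ 2 = e ^ 2 = 2 x - x ^ 2]. The two roots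
agree after applying [f], as [(w - x) (2 - w - x) = 0] and [f w + f x] has norm less
than [2]. *)
Lemma star_hom_inj_sqr b : b^# = b -> rnorm b <= 1 ->
  rnorm (f b) ^+ 2 < 2^-1 -> rnorm b ^+ 2 <= 2^-1.
Proof.
move=> sb b1 fb.
have [d [sd bd dd]] := exists_cosine sb b1.
pose x := (b ** b) *+ 2.
pose e := (b - b ** d) *+ 2.
have sbb : (b ** b)^# = b ** b by rewrite cstarM sb.
have nx (C : cstarAlgType R) (y : C) : y^# = y ->
    rnorm ((y ** y) *+ 2) = 2 * rnorm y ^+ 2.
  move=> sy; rewrite -scaler_nat -(rmorph_nat (real_complex R)) rnormZ ger0_norm//.
  by rewrite rnorm_sqr.
have ee : x *+ 2 = e ** e + x ** x.
  by rewrite !cmulMnl !cmulMnr -!mulrnDl cosine_sub_sqr// subrK.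
have se : e^# = e.
  by rewrite /e mulr2n cstarD cstarB cstarM sb sd bd.
have sx : x^# = x by rewrite /x mulr2n cstarD sbb.
have ex : e ** x = x ** e.
  by rewrite !cmulMnl !cmulMnr cosine_sub_comm.
have e1 : rnorm e <= 1 by exact: rnorm_le1_of_circle se sx ex ee.
have [|w [w1 w2 comm_w _]] := @sqrt_one_sub _ _ (e ** e).
  by rewrite rnorm_sqr// exprn_ile1 ?rnorm_ge0.
have xw : x ** w = w ** x by apply: comm_w; rewrite cmulA -ex -cmulA -ex cmulA.
have fx1 : rnorm (f x) < 1.
  rewrite star_homMn (star_hom_mul hf) nx ?star_hom_sa//; lra.
have fw1 : rnorm (f w) <= 1 by rewrite (le_trans (star_hom_contractive _)).
have fxw : (f w - f x) *+ 2 = (f w - f x) ** (f w + f x).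
  rewrite -star_homB -star_homD -star_homMn -(star_hom_mul hf).
  congr (f _); rewrite mulrnBl w2 ee; move: (e) (x) xw => e' x' xw'.
  rewrite cmulBl !cmulDr xw'.
  by rewrite (addrC (e' ** e') (w ** w)) !opprD !addrA !addrK.
have wx : w = x.
  apply: f_inj; apply: subr0_eq; apply: rnorm0_eq0; apply/eqP.
  rewrite eq_le rnorm_ge0 andbT leNgt; apply/negP => gt0.
  have := rnormM (f w - f x) (f w + f x); rewrite -fxw.
  rewrite -scaler_nat -(rmorph_nat (real_complex R)) rnormZ ger0_norm//.
  rewrite mulrC ler_pM2l//.
  by have := rnormD (f w) (f x); lra.
by have := nx _ _ sb; rewrite -/x -wx; lra.
Qed.

(** If [`|f b| < `|b|], rescaling [b] so that [`|f b| ^ 2 + `|b| ^ 2 = 1] puts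
[1 / 2] strictly between the two squares, against [star_hom_inj_sqr]. *)
Theorem star_hom_inj_isometric a : rnorm (f a) = rnorm a.
Proof.
apply/le_anti; rewrite star_hom_contractive/=.
have sa_case b : b^# = b -> rnorm b <= rnorm (f b).
  move=> sb; rewrite leNgt; apply/negP => lt_fb.
  have fb0 := rnorm_ge0 (f b).
  pose s := rnorm (f b) ^+ 2 + rnorm b ^+ 2.
  have s0 : 0 < s by rewrite /s; nra.
  pose t := Num.sqrt s^-1.
  have t2 : t ^+ 2 = s^-1 by rewrite sqr_sqrtr// invr_ge0 ltW.
  have t0 : 0 <= t by exact: sqrtr_ge0.
  have lt2 : rnorm (f b) ^+ 2 < rnorm b ^+ 2 by rewrite ltr_pXn2r ?nnegrE ?rnorm_ge0.
  have := @star_hom_inj_sqr (t%:C *: b).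
  rewrite cstarZr sb star_homZ !rnormZ ger0_norm// !exprMn t2.
  rewrite -(@ler_pXn2r _ 2 _ (t * _) 1) ?nnegrE ?mulr_ge0 ?rnorm_ge0//.
  rewrite exprMn t2 expr1n.
  rewrite !(mulrC s^-1) ler_pdivrMr// ltr_pdivrMr// ler_pdivrMr// mul1r.
  have s_ge : rnorm b ^+ 2 <= s by rewrite /s; nra.
  have fb_lt : rnorm (f b) ^+ 2 < 2^-1 * s by rewrite /s; lra.
  by move=> /(_ erefl s_ge fb_lt); rewrite /s; lra.
rewrite -(@ler_pXn2r _ 2) ?nnegrE ?rnorm_ge0// -!rnorm_starM.
by rewrite -(star_hom_star hf) -(star_hom_mul hf) sa_case// cstarM cstarK.
Qed.

End StarHom.

(** * Density and completeness *)

Section Density.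
Context (R : realType).

Lemma dense_rnorm (V : normedModType R[i]) (S : set V) : dense S ->
  forall (x : V) e, 0 < e -> exists2 y, S y & rnorm (x - y) < e.
Proof.
move=> denseS x e e0.
have e0' : (0 : R[i]) < e%:C by rewrite ltcR.
have [|y [xy Sy]] := denseS (ball x e%:C) _ (ball_open x e%:C).
  by exists x; exact: ballxx.
by exists y => //; move: xy; rewrite -ball_normE/= rnormE ltcR.
Qed.

Lemma dense_mdist (I : metricType R) (S : set I) : dense S ->
  forall (x : I) r, 0 < r -> exists2 y, S y & mdist x y < r.
Proof.
move=> denseS x r r0.
have [|y [xy Sy]] := denseS (ball x r)^° _ (open_interior _).
  by exists x; exact: nbhsx_ballx.
by exists y => //; move: (interior_subset xy); rewrite ballEmdist.
Qed.

(** Preimages of a sequence converging to [b] form a Cauchy sequence, since [f]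
preserves distances. *)
Lemma star_hom_dense_surj (A B : cstarAlgType R) (f : A -> B) :
  star_hom f -> (forall a, rnorm (f a) = rnorm a) -> dense (range f) ->
  forall b, exists a, f a = b.
Proof.
move=> hf isof densef b.
have approx n : exists a, rnorm (b - f a) < n.+1%:R^-1.
  have n0 : (0 : R) < n.+1%:R^-1 by rewrite invr_gt0 ltr0n.
  by have [_ [a _ <-] ba] := dense_rnorm densef b n0; exists a.
have [u bu] := boolp.choice approx.
have bu_small e : 0 < e -> exists N, forall n, (N <= n)%N -> rnorm (b - f (u n)) < e.
  move=> e0; have [N _ le_e] := near_infty_natSinv_lt (PosNum e0).
  by exists N => n Nn; apply: lt_trans (le_e n Nn).
have [|a ua] := @rnorm_complete _ A u.
  move=> e e0; have [|N bN] := bu_small (e / 2); first by rewrite divr_gt0.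
  exists N => n Nn; rewrite -isof (star_homB hf).
  have := rnorm_distD b (f (u n)) (f (u N)).
  by have := bN _ Nn; have := bN _ (leqnn N); rewrite (rnorm_distC b (f (u n))); lra.
exists a; apply/subr0_eq; apply: (@rnorm_le_eps _ _ 2) => e e0.
have [N1 h1] := ua _ e0; have [N2 h2] := bu_small _ e0.
have := rnorm_distD (f (u (N1 + N2)%N)) (f a) b.
rewrite -(star_homB hf) isof (rnorm_distC (f (u _)) b).
have := h1 _ (leq_addr N2 N1); have := h2 _ (leq_addl N1 N2); lra.
Qed.

End Density.

(** * Uniformly continuous functions *)

Section UCbFunctions.
Context (R : realType) (I : metricType R).

(** The target is a space over [R[i]] and the source a space over [R], so the
proof goes through entourages. *)
Lemma UCb_lipschitz (g : I -> R) (K M : R) :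
  (forall x y, `|g x - g y| <= K * mdist x y) -> (forall x, `|g x| <= M) ->
  UCb (fun x => (g x)%:C).
Proof.
move=> lipg gM; split.
  move=> E; rewrite -entourage_ballE => -[e /=].
  rewrite ltcE/= => /andP[/eqP Im0 e0] eE.
  have K1 : 0 < `|K| + 1 by rewrite ltr_wpDl.
  have r0 : 0 < complex.Re e / (`|K| + 1) by rewrite divr_gt0.
  apply: filterS (entourage_ball _ (PosNum r0)) => -[x y]/=.
  rewrite ballEmdist/= ltr_pdivlMr// => xy.
  apply: eE => /=; rewrite -ball_normE/=.
  rewrite -rmorphB/= normc_def/= expr0n/= addr0 sqrtr_sqr ltcE/= Im0 eqxx/=.
  apply: le_lt_trans xy; apply: (le_trans (lipg x y)).
  rewrite mulrC ler_wpM2l ?mdist_ge0//.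
  by have := ler_norm K; lra.
exists M%:C; split; first by rewrite complex_real.
move=> N MN x _ /=.
rewrite normc_def/= expr0n/= addr0 sqrtr_sqr.
by apply: le_trans (ltW MN); rewrite lecR.
Qed.

Lemma UCb_Re_continuous (g : I -> R[i]) : UCb g -> forall x e, 0 < e ->
  exists2 r, 0 < r & forall y, mdist x y < r ->
    `|complex.Re (g x) - complex.Re (g y)| < e.
Proof.
move=> [ucg _] x e e0.
have e0' : (0 : R[i]) < e%:C by rewrite ltcR.
have := ucg _ (entourage_ball _ (PosNum e0')).
rewrite /= -[nbhs _ _]/(entourage _) -entourage_ballE => -[r r0 rE].
exists r => // y xy.
have /= := rE (x, y); rewrite /ball_ ballEmdist => /(_ xy).
rewrite -ball_normE/= => lt_e; rewrite -ltcR; apply: le_lt_trans lt_e.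
by rewrite -raddfB; exact: normc_ge_Re.
Qed.

End UCbFunctions.

Local Notation evalb := Defs.eval.

(** * Sections of bundles *)

Section Bundles.
Context (R : realType) (I : metricType R) (A : UCb_bundle I).
Implicit Types a b : sections A.

(** Over an empty base every section is [0], which is where [0 <= e] enters. *)
Lemma rnorm_section_le a e : 0 <= e ->
  (forall h, rnorm (evalb h a) <= e) -> rnorm a <= e.
Proof.
move=> e0 le_e; rewrite {1}/rnorm norm_sup /=.
have [->|/set0P ne] := eqVneq (range (fun h => complex.Re `|evalb h a|)) set0.
  by rewrite sup0.
by apply: ge_sup => // _ [h _ <-]; exact: le_e.
Qed.

Lemma rnorm_eval_continuous a h e : 0 < e -> exists2 r, 0 < r &
  forall k, mdist h k < r -> `|rnorm (evalb h a) - rnorm (evalb k a)| < e.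
Proof. exact: (UCb_Re_continuous (norm_UCb a)). Qed.

Lemma eval_eq_dense (S : set I) a b : dense S ->
  (forall h, S h -> evalb h a = evalb h b) -> a = b.
Proof.
move=> denseS eq_ab; apply/subr0_eq/rnorm0_eq0/le_anti; rewrite rnorm_ge0 andbT.
apply: rnorm_section_le => // h; apply/ler_addgt0Pl => e e0; rewrite addr0.
have [r r0 near_h] := rnorm_eval_continuous (a - b) h e0.
have [k Sk /near_h] := dense_mdist denseS h r0.
rewrite [evalb k _](star_homB (eval_star_hom A k)) (eq_ab k Sk) subrr rnorm0 subr0.
by rewrite ger0_norm ?rnorm_ge0// => /ltW.
Qed.

End Bundles.

Section MinimalExtension.
Context (R : realType) (I J : metricType R) (A : UCb_bundle I) (B : UCb_bundle J).
Context (s : bundle_hom A B).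

(** At a point [base_map s h], compatibility with the fibers compares [a'] with
the constant multiple [f (base_map s h) *: a], which has the same value at [h].
The other points are reached by density. *)
Lemma section_map_scale (f : J -> R[i]) (a a' : sections A) :
  UCb f -> dense (range (base_map s)) ->
  (forall h, evalb h a' = f (base_map s h) *: evalb h a) ->
  forall k, evalb k (section_map s a') = f k *: evalb k (section_map s a).
Proof.
move=> ucf dense_s a'E k.
have [b bE] := UCb_scale ucf (section_map s a).
rewrite -bE; congr (evalb k _); apply: (eval_eq_dense dense_s) => _ [h _ <-].
rewrite bE -(star_homZ (eval_star_hom _ _)) -(star_homZ (section_map_star_hom s)).
by apply: fiber_compat; rewrite a'E (star_homZ (eval_star_hom _ _)).
Qed.

End MinimalExtension.

(** * Comparison of two extensions *)

Section Bump.
Context (R : realType) (J : metricType R) (j : J) (r : R).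

Definition bump (k : J) : R := Num.max 0 (1 - mdist j k / r).

Lemma bump_bounds k : 0 < r -> 0 <= bump k <= 1.
Proof.
move=> r0; rewrite /bump le_max lexx/= ge_max ler01/=.
by rewrite lerBlDr lerDl divr_ge0 ?mdist_ge0// ltW.
Qed.

Lemma bump_center : bump j = 1.
Proof. by rewrite /bump mdistxx mul0r subr0; apply/max_idPr. Qed.

Lemma bump_eq0 k : 0 < r -> r <= mdist j k -> bump k = 0.
Proof. by move=> r0 rk; apply/max_idPl; rewrite subr_le0 ler_pdivlMr// mul1r. Qed.

Lemma bump_lipschitz k l : 0 < r -> `|bump k - bump l| <= r^-1 * mdist k l.
Proof.
move=> r0.
have le1 : mdist j k / r <= mdist j l / r + r^-1 * mdist k l.
  rewrite (mulrC r^-1) -mulrDl ler_pM2r ?invr_gt0// (metric_sym k l).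
  exact: metric_triangle.
have le2 : mdist j l / r <= mdist j k / r + r^-1 * mdist k l.
  rewrite (mulrC r^-1) -mulrDl ler_pM2r ?invr_gt0//.
  exact: metric_triangle.
rewrite ler_norml /bump; case: (leP 0 (1 - mdist j k / r));
  case: (leP 0 (1 - mdist j l / r)) => hl hk; apply/andP; split; lra.
Qed.

Lemma UCb_bump_comp (I : metricType R) (g : I -> J) :
  0 < r -> metric_map g -> UCb (fun h => (bump (g h))%:C).
Proof.
move=> r0 mg; apply: (@UCb_lipschitz _ _ _ r^-1 1) => [x y|x].
  apply: (le_trans (bump_lipschitz _ _ r0)).
  by rewrite ler_pM2l ?invr_gt0// mg.
by rewrite ger0_norm; case/andP: (bump_bounds (g x) r0).
Qed.

End Bump.

Section Comparison.
Context (R : realType) (I J : metricType R) (A : UCb_bundle I).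
Context (B C : UCb_bundle J) (s : bundle_hom A B) (t : bundle_hom A C).
Hypothesis st : base_map s = base_map t.
Hypothesis dense_s : dense (range (base_map s)).
Hypothesis s_inj : injective (section_map s).

(** A bump function [f] at [j] lifts to [a'], whose images under the two section
maps are [f] times those of [a]. The first is small since [section_map s a] is
small on the support of [f], and the norm of [a'] is that of its first image. *)
Lemma kernel_transfer (a : sections A) (j : J) :
  evalb j (section_map s a) = 0 -> evalb j (section_map t a) = 0.
Proof.
move=> sa0; apply: (@rnorm_le_eps _ _ 1) => e e0; rewrite mul1r.
have [r r0 near_j] := rnorm_eval_continuous (section_map s a) j e0.
have ucJ := UCb_bump_comp j r0 (fun x y : J => lexx (mdist x y)).
have ucI := UCb_bump_comp j r0 (@base_map_metric _ _ _ _ _ s).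
have [a' a'E] := UCb_scale ucI a.
have sa' := section_map_scale ucJ dense_s a'E.
have dense_t : dense (range (base_map t)) by rewrite -st.
have ta' := section_map_scale (s := t) ucJ dense_t.
rewrite st in a'E.
have := ta' _ _ a'E j; rewrite bump_center rmorph1 scale1r => <-.
have hs := section_map_star_hom s; have ht := section_map_star_hom t.
apply: (le_trans (star_hom_contractive (eval_star_hom _ _) _)).
apply: (le_trans (star_hom_contractive ht _)).
rewrite -(star_hom_inj_isometric hs s_inj).
apply: rnorm_section_le => [|k]; first exact: ltW.
rewrite sa' rnormZ.
have /andP[b0 b1] := bump_bounds j k r0; rewrite ger0_norm//.
have [kr|rk] := ltP (mdist j k) r; last by rewrite bump_eq0// mul0r ltW.
have := near_j k kr; rewrite sa0 rnorm0 sub0r normrN ger0_norm ?rnorm_ge0// => lt_e.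
have := rnorm_ge0 (evalb k (section_map s a)); nra.
Qed.

End Comparison.

Theorem theorem4p2 (R : realType) (I J : metricType R)
  (lcI : locally_compact [set: I]) (lcJ : locally_compact [set: J])
  (A : UCb_bundle I) (alpha : I -> J)
  (alpha_isometric : isometric alpha) (alpha_dense : dense (range alpha))
  (B C : UCb_bundle J)
  (minB : minimal_extension alpha A B) (minC : minimal_extension alpha A C) :
  isomorphic B C.
Proof.
have [s [sE [_ s_inj] _ dense_s dense_B]] := minB.
have [t [tE [_ t_inj] _ dense_t dense_C]] := minC.
have hs := section_map_star_hom s; have ht := section_map_star_hom t.
have s_surj := star_hom_dense_surj hs (star_hom_inj_isometric hs s_inj) dense_B.
have t_surj := star_hom_dense_surj ht (star_hom_inj_isometric ht t_inj) dense_C.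
have [s' s'K] := boolp.choice s_surj.
have [t' t'K] := boolp.choice t_surj.
have sK : cancel (section_map s) s' by move=> a; apply: s_inj; rewrite s'K.
have tK : cancel (section_map t) t' by move=> a; apply: t_inj; rewrite t'K.
pose delta b := section_map t (s' b).
have hs' : star_hom s'.
  split=> [k x y|x y|x]; apply: s_inj.
  - by rewrite (star_homD hs) (star_homZ hs) !s'K.
  - by rewrite (star_hom_mul hs) !s'K.
  - by rewrite (star_hom_star hs) !s'K.
have hdelta : star_hom delta.
  split=> [k x y|x y|x]; rewrite /delta.
  - by rewrite (star_hom_linear hs') (star_homD ht) (star_homZ ht).
  - by rewrite (star_hom_mul hs') (star_hom_mul ht).
  - by rewrite (star_hom_star hs') (star_hom_star ht).
have metric_id : metric_map (@id J) by move=> x y.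
have compat b1 b2 (j : J) :
    evalb j b1 = evalb j b2 -> evalb j (delta b1) = evalb j (delta b2).
  move=> eq_b; apply: subr0_eq.
  rewrite -(star_homB (eval_star_hom C j)) -(star_homB hdelta).
  apply: (@kernel_transfer _ _ _ _ _ _ s t); rewrite ?sE ?tE//.
  by rewrite s'K (star_homB (eval_star_hom B j)) eq_b subrr.
exists (@Build_bundle_hom _ _ _ B C id delta metric_id hdelta compat).
split=> //=; first by rewrite image_id.
by exists (section_map s \o t') => x /=; rewrite /delta ?sK ?t'K ?tK ?s'K.
Qed.
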